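(* Let $K$ be a compact abelian group with dual group $\Gamma=\widehat K$, let $A$ be a $*$-algebra, and let $\alpha,\beta:K\to\mathrm{Aut}(A)$ be two actions by $*$-automorphisms whose finite spectral cores $A_{\mathrm{fin}}^\alpha$ and $A_{\mathrm{fin}}^\beta$ coincide as vector spaces. Assume further that $A_{\mathrm{fin}}^\alpha$ is algebraically the direct sum of its spectral subspaces and that $\alpha$ and $\beta$ are determined by their values on $A_{\mathrm{fin}}^\alpha$ (e.g. $A_{\mathrm{fin}}^\alpha$ is dense in a chosen topology and $\alpha,\beta$ are continuous). (i) If $A_\gamma^\alpha=A_\gamma^\beta$ for all $\gamma\in\Gamma$, then $\alpha=\beta$. (ii) Let $\psi\in\mathrm{Aut}(K)$ and let $\widehat\psi:\Gamma\to\Gamma$ be the induced automorphism $\widehat\psi(\gamma):=\gamma\circ\psi^{-1}$. Then $\beta=\alpha\circ\psi$ holds if and only if $A_\gamma^\beta=A_{\widehat\psi(\gamma)}^\alpha$ for all $\gamma\in\Gamma$.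
   Context: For an action $\alpha$ of $K$ on $A$ and $\gamma\in\Gamma$, the spectral subspace is $A_\gamma^\alpha:=\{a\in A:\alpha_t(a)=\gamma(t)a\ \forall t\in K\}$ and the finite spectral core is $A_{\mathrm{fin}}^\alpha:=\bigoplus^{\mathrm{alg}}_\gamma A_\gamma^\alpha$. $\mathrm{Aut}(K)$ is the group of (topological group) automorphisms of $K$, and $(\alpha\circ\psi)_t=\alpha_{\psi(t)}$. ''Determined by their values on $A_{\mathrm{fin}}^\alpha$'' means: whenever $s,t\in K$ and $\alpha_s$, $\beta_t$ agree on $A_{\mathrm{fin}}^\alpha$, then $\alpha_s=\beta_t$ on $A$. *)

(* Defs.v *)
From HB Require Import structures.
From mathcomp Require Import all_boot all_order all_algebra.
From mathcomp Require Import complex.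
From mathcomp Require Import all_classical all_reals all_analysis.

Set Implicit Arguments.
Unset Strict Implicit.
Unset Printing Implicit Defensive.

Import Order.TTheory GRing.Theory Num.Theory.
Import numFieldNormedType.Exports.

Local Open Scope classical_set_scope.
Local Open Scope ring_scope.

(* Neither a unit nor nontriviality is required, so the MathComp algebra
   structures cannot be reused for the product. *)
HB.mixin Record Lmodule_isStarAlgebra (C : numClosedFieldType) A
    of GRing.Lmodule C A := {
  smul : A -> A -> A;
  star : A -> A;
  smulA : associative smul;
  smulDl : left_distributive smul +%R;
  smulDr : right_distributive smul +%R;
  smulZl : forall (c : C) (a b : A), smul (c *: a) b = c *: smul a b;
  smulZr : forall (c : C) (a b : A), smul a (c *: b) = c *: smul a b;
  starD : {morph star : a b / a + b};
  starZ : forall (c : C) (a : A), star (c *: a) = c^* *: star a;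
  starM : forall a b : A, star (smul a b) = smul (star b) (star a);
  starK : involutive star;
}.

#[short(type="starAlgType")]
HB.structure Definition StarAlgebra (C : numClosedFieldType) :=
  {A of GRing.Lmodule C A & Lmodule_isStarAlgebra C A}.

Section Dual.
Variables (R : realType) (K : topologicalZmodType).

(* The circle group is the set of z : R[i] with `|z| = 1; the type R[i]^o is
   R[i] equipped with the topology of its norm. *)
Record dual := Character {
  char_fun :> K -> R[i];
  char_norm : forall t, `|char_fun t| = 1;
  charD : forall s t, char_fun (s + t) = char_fun s * char_fun t;
  char_continuous : continuous (char_fun : K -> R[i]^o);
}.

HB.instance Definition _ := gen_eqMixin dual.
HB.instance Definition _ := gen_choiceMixin dual.

Lemma dual_eqP (g h : dual) : g =1 h -> g = h.
Proof.
case: g h => [g g1 g2 g3] [h h1 h2 h3] /= /funext gh; subst h.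
by congr Character; exact: Prop_irrelevance.
Qed.

Lemma char_neq0 (g : dual) t : g t != 0.
Proof. by rewrite -normr_eq0 char_norm oner_eq0. Qed.

Fact dual_zero_norm (t : K) : `|1 : R[i]| = 1.
Proof. exact: normr1. Qed.
Fact dual_zeroD (s t : K) : 1 = 1 * 1 :> R[i].
Proof. by rewrite mulr1. Qed.
Fact dual_zero_continuous : continuous ((fun=> 1) : K -> R[i]^o).
Proof. by move=> t; exact: cvg_cst. Qed.
Definition dual_zero : dual :=
  Character dual_zero_norm dual_zeroD dual_zero_continuous.

Fact dual_opp_norm (g : dual) t : `|(g t)^-1| = 1.
Proof. by rewrite normfV char_norm invr1. Qed.
Fact dual_oppD (g : dual) s t : (g (s + t))^-1 = (g s)^-1 * (g t)^-1.
Proof. by rewrite charD invfM. Qed.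
Fact dual_opp_continuous (g : dual) :
  continuous ((fun t => (g t)^-1) : K -> R[i]^o).
Proof.
by move=> t; apply: cvgV; [exact: char_neq0 | exact: char_continuous].
Qed.
Definition dual_opp (g : dual) : dual :=
  Character (dual_opp_norm g) (dual_oppD g) (@dual_opp_continuous g).

Fact dual_add_norm (g h : dual) t : `|g t * h t| = 1.
Proof. by rewrite normrM !char_norm mulr1. Qed.
Fact dual_addD (g h : dual) s t :
  g (s + t) * h (s + t) = g s * h s * (g t * h t).
Proof. by rewrite !charD mulrACA. Qed.
Fact dual_add_continuous (g h : dual) :
  continuous ((fun t => g t * h t) : K -> R[i]^o).
Proof. by move=> t; apply: cvgM; exact: char_continuous. Qed.
Definition dual_add (g h : dual) : dual :=
  Character (dual_add_norm g h) (dual_addD g h) (@dual_add_continuous g h).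

Lemma dual_addA : associative dual_add.
Proof. by move=> f g h; apply: dual_eqP => t /=; rewrite mulrA. Qed.
Lemma dual_addC : commutative dual_add.
Proof. by move=> g h; apply: dual_eqP => t /=; rewrite mulrC. Qed.
Lemma dual_add0 : left_id dual_zero dual_add.
Proof. by move=> g; apply: dual_eqP => t /=; rewrite mul1r. Qed.
Lemma dual_addN : left_inverse dual_zero dual_opp dual_add.
Proof.
by move=> g; apply: dual_eqP => t /=; rewrite mulVf // char_neq0.
Qed.

(* The group law of the dual, pointwise multiplication, is written additively. *)
HB.instance Definition _ :=
  GRing.isZmodule.Build dual dual_addA dual_addC dual_add0 dual_addN.

End Dual.

Record topAut (K : topologicalZmodType) := TopAut {
  aut_fun :> K -> K;
  aut_inv : K -> K;
  aut_funD : {morph aut_fun : s t / s + t};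
  aut_funK : cancel aut_fun aut_inv;
  aut_invK : cancel aut_inv aut_fun;
  aut_fun_continuous : continuous aut_fun;
  aut_inv_continuous : continuous aut_inv;
}.

Section DualAut.
Variables (R : realType) (K : topologicalZmodType).

Lemma aut_invD (psi : topAut K) : {morph aut_inv psi : s t / s + t}.
Proof.
move=> s t; apply: (can_inj (aut_funK psi)).
by rewrite aut_funD !aut_invK.
Qed.

Fact dual_aut_norm (psi : topAut K) (g : dual R K) t :
  `|(g \o aut_inv psi) t| = 1.
Proof. exact: char_norm. Qed.
Fact dual_aut_charD (psi : topAut K) (g : dual R K) s t :
  (g \o aut_inv psi) (s + t) = (g \o aut_inv psi) s * (g \o aut_inv psi) t.
Proof. by rewrite /= aut_invD charD. Qed.
Fact dual_aut_continuous (psi : topAut K) (g : dual R K) :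
  continuous (g \o aut_inv psi : K -> R[i]^o).
Proof.
move=> t; apply: (continuous_comp (@aut_inv_continuous _ psi t)).
exact: char_continuous.
Qed.
Definition dual_aut (psi : topAut K) (g : dual R K) : dual R K :=
  Character (dual_aut_norm psi g) (dual_aut_charD psi g)
    (@dual_aut_continuous psi g).

Lemma dual_autD (psi : topAut K) : {morph dual_aut psi : g h / g + h}.
Proof. by move=> g h; exact: dual_eqP. Qed.

Lemma dual_aut_bij (psi : topAut K) : bijective (dual_aut psi).
Proof.
pose phi := TopAut (aut_invD psi) (aut_invK psi) (aut_funK psi)
  (@aut_inv_continuous _ psi) (@aut_fun_continuous _ psi).
exists (dual_aut phi) => g; apply: dual_eqP => t /=.
- by rewrite aut_funK.
- by rewrite aut_invK.
Qed.

End DualAut.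

Section Actions.
Variables (R : realType) (K : topologicalZmodType) (A : starAlgType R[i]).

Record star_automorphism (f : A -> A) : Prop := {
  star_aut_linear : linear f;
  star_autM : {morph f : a b / smul a b};
  star_aut_star : {morph f : a / star a};
  star_aut_bij : bijective f;
}.

Record star_action (alpha : K -> A -> A) : Prop := {
  star_action_aut : forall t, star_automorphism (alpha t);
  star_action0 : alpha 0 = id;
  star_actionD : forall s t, alpha (s + t) = alpha s \o alpha t;
}.

Definition spectral_subspace (alpha : K -> A -> A) (g : dual R K) : set A :=
  [set a | forall t, alpha t a = g t *: a].

Definition spectral_family (alpha : K -> A -> A) : set (dual R K -> A) :=
  [set f | (forall g, spectral_subspace alpha g (f g)) /\
           finite_set [set g | f g != 0]].

Definition spectral_core (alpha : K -> A -> A) : set A :=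
  [set \sum_(g \in [set: dual R K]) f g | f in spectral_family alpha].

(* The internal sum of the spectral subspaces is direct: decompositions are
   unique. *)
Definition spectral_core_direct (alpha : K -> A -> A) : Prop :=
  forall f f', spectral_family alpha f -> spectral_family alpha f' ->
    \sum_(g \in [set: dual R K]) f g = \sum_(g \in [set: dual R K]) f' g ->
    f = f'.

Definition determined_on_core (alpha beta : K -> A -> A) : Prop :=
  forall s t, {in spectral_core alpha, alpha s =1 beta t} ->
    alpha s = beta t.

End Actions.

(* Main.v *)
Require Import Defs.
From mathcomp Require Import all_boot all_order all_algebra.
From mathcomp Require Import complex.
From mathcomp Require Import all_classical all_reals all_analysis.

Local Open Scope classical_set_scope.
Local Open Scope ring_scope.

(** On the core an action is diagonal: at time [s] it multiplies the component of character [g] by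
    [g s]. Comparing [alpha s] with [beta t] thus reduces to comparing scalars on each spectral
    subspace of [alpha]. Equal subspaces give the same scalars at [s = t]; subspaces relabelled by
    [dual_aut psi] give them at [s = psi t], since [dual_aut psi g (psi t) = g t]. *)

(* Two actions scaling each spectral component of [alpha] by the same scalars
   agree on finite sums of such components, hence everywhere once they are
   determined by the core. *)
Lemma spectral_scaling_eq (R : realType) (K : topologicalZmodType)
    (A : starAlgType R[i]) (alpha beta : K -> A -> A) (s t : K) :
  star_action alpha -> star_action beta ->
  determined_on_core alpha beta ->
  (forall (g : dual R K) a, spectral_subspace alpha g a ->
     beta t a = g s *: a) ->
  alpha s = beta t.
Proof.
move=> ha hb det hab; apply: det => a; rewrite inE => -[f [fA _] <-].
have lin_sum (u : A -> A) : linear u -> forall r : seq (dual R K),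
    u (\sum_(g <- r) f g) = \sum_(g <- r) u (f g).
  move=> ulin; have uD x y : u (x + y) = u x + u y.
    by rewrite -[x in LHS]GRing.scale1r ulin GRing.scale1r.
  have u0 : u 0 = 0.
    by apply: (@GRing.addrI _ (u 0)); rewrite -uD !GRing.addr0.
  by move=> r; rewrite (big_morph u uD u0).
have alin := star_aut_linear (star_action_aut ha s).
have blin := star_aut_linear (star_action_aut hb t).
rewrite (lin_sum _ alin) (lin_sum _ blin); apply: eq_bigr => g _.
by rewrite (fA g s) (hab g).
Qed.

Theorem proposition11p3 (R : realType) (K : topologicalZmodType)
    (A : starAlgType R[i]) (alpha beta : K -> A -> A) :
  compact [set: K] -> hausdorff_space K ->
  star_action alpha -> star_action beta ->
  spectral_core alpha = spectral_core beta ->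
  spectral_core_direct alpha ->
  determined_on_core alpha beta ->
  ((forall g : dual R K, spectral_subspace alpha g = spectral_subspace beta g) ->
     alpha = beta) /\
  (forall psi : topAut K,
     beta = alpha \o psi <->
     (forall g : dual R K,
        spectral_subspace beta g = spectral_subspace alpha (dual_aut psi g))).
Proof.
move=> _ _ ha hb _ _ det; split=> [hsub|psi].
  apply/funext => t; apply: spectral_scaling_eq => // g a.
  by rewrite hsub => /(_ t).
split=> [-> g|hsub].
  apply/seteqP; split=> a ga t /=.
    (* As [psi] is onto, the eigenvalue equations at all [psi t] are those at all times. *)
    by have := ga (aut_inv psi t); rewrite /= aut_invK.
  by have := ga (psi t); rewrite /= aut_funK.
apply/funext => t; apply/esym.
apply: (@spectral_scaling_eq R K A alpha beta (psi t) t) => // g a ga.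
(* Surjectivity of [dual_aut psi] is needed here: the hypothesis only describes subspaces of [alpha]
   whose label lies in its image. *)
have [inv _ invK] := dual_aut_bij R psi.
move: ga; rewrite -[g]invK -hsub => /(_ t) -> /=.
by rewrite aut_funK.
Qed.
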